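(* Assume $d=1$. Let $T>0$, let $\nu>0$, let $q\in C^2(\mathbb{R};\mathbb{R})$, and let $m$ be a smooth solution of $$\partial_t m-\nu\,\partial_{xx}m+q(x)\,\partial_x m=0\quad\text{in }\mathbb{R}\times[0,T].$$ Let $\Delta t=T/N_T>0$ with $N_T$ a positive integer, and let $t_k=k\Delta t$ for $k=0,\dots,N_T$. Let $\mathcal{L}$ be a finite index set, with nodes $\{\xi_\ell\}_{\ell\in\mathcal{L}}\subset\mathbb{R}$ and weights $\{\omega_\ell\}_{\ell\in\mathcal{L}}\subset\mathbb{R}$, and consider the scheme $$m_{k+1}(x)=\sum_{\ell\in\mathcal{L}}\omega_\ell\,m_k\big(\Psi^-_\ell(x)\big),\qquad \Psi^-_\ell(x)=x-\frac{\Delta t}{2}\Big(q(x)+q\big(x-\Delta t\,q(x)+\xi_\ell\big)\Big)+\xi_\ell .$$ Define the corresponding one-step error, for $x\in\mathbb{R}$ and $k\in\{0,\dots,N_T-1\}$, by $$\mathcal{T}_k(x)=m(x,t_{k+1})-\sum_{\ell\in\mathcal{L}}\omega_\ell\,m\big(\Psi^-_\ell(x),t_k\big).$$ Assume that the nodes and weights satisfy the moment-matching conditions $$\sum_{\ell\in\mathcal{L}}\omega_\ell\,\xi_\ell^{j}=\int_{\mathbb{R}}y^{j}\,G(y;\Delta t)\,dy,\qquad j=0,1,\dots,5,$$ where $G(\cdot;\Delta t)$ is the Gaussian probability density on $\mathbb{R}$ with mean $0$ and variance $2\nu\Delta t$. Then there exists a constant $C$, depending only on $T$ and the uniform norms of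 the derivatives of $m$ and $q$, such that $$\sup_{x\in\mathbb{R},\;k\in\{0,\dots,N_T-1\}}|\mathcal{T}_k(x)|\le C\,(\Delta t)^3.$$
   Context: The scheme is a semi-Lagrangian time discretization of the one-dimensional advection-diffusion equation with constant viscosity $\nu$ and time-independent drift $q$; $m_k$ denotes the approximation of $m(\cdot,t_k)$, and $\Psi^-_\ell$ is the backward flow map obtained from a Crank-Nicolson type discretization of the characteristics, with $\xi_\ell$ the quadrature node replacing the Brownian increment.
   Formalization: C depends, besides T and a bound on the derivatives of m and on q, q', q'' (q itself bounded), also on the size Σ|ω_ℓ|(1+(ξ_ℓ²/Δt)³) of the quadrature rule; without such dependence the claim is false, since the moments up to order 5 do not control the error. *)

(* Defs.v *)
From HB Require Import structures.
From mathcomp Require Import all_boot all_order all_algebra.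
From mathcomp Require Import all_classical all_reals all_analysis.

Set Implicit Arguments.
Unset Strict Implicit.
Unset Printing Implicit Defensive.

Import Order.TTheory GRing.Theory Num.Theory.
Import numFieldNormedType.Exports.

Local Open Scope classical_set_scope.
Local Open Scope ring_scope.

Definition slab (R : realType) (T : R) : set (R * R) :=
  [set p : R * R | 0 <= p.2 <= T].

(* m is C^oo on R x [0, T] and D i j is its derivative of order i in x and j in
   t.  The time derivatives are required in the open interval only; up to
   t = 0 and t = T every D i j is a continuous extension, so that nothing is
   asked of m outside the slab. *)
Definition smooth_on_slab (R : realType) (T : R) (m : R -> R -> R)
    (D : nat -> nat -> R -> R -> R) : Prop :=
  [/\ forall x t : R, 0 <= t <= T -> D 0%N 0%N x t = m x t,
      forall i j, {within slab T, continuous (fun p : R * R => D i j p.1 p.2)},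
      forall i j (x t : R), 0 <= t <= T ->
        is_derive x 1 (fun y => D i j y t) (D i.+1 j x t)
    & forall i j (x t : R), 0 < t < T ->
        is_derive t 1 (fun s => D i j x s) (D i j.+1 x t)].

Definition C2 (R : realType) (q : R -> R) : Prop :=
  [/\ forall x : R, derivable q x 1,
      forall x : R, derivable (derive1 q : R -> R) x 1
    & continuous (derive1n 2 q : R -> R)].

(* The order of a derivative of m is counted parabolically: one derivative in t
   weighs as much as two in x.  The norm of m itself is not needed. *)
Definition derivatives_bounded (R : realType) (T : R)
    (D : nat -> nat -> R -> R -> R) (q : R -> R) (M : R) : Prop :=
  (forall i j, (1 <= i + 2 * j <= 6)%N ->
     forall x t : R, 0 <= t <= T -> `|D i j x t| <= M) /\
  (forall i, (i <= 2)%N -> forall x : R, `|derive1n i q x| <= M).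

Definition psi_minus (R : realType) (q : R -> R) (dt xi x : R) : R :=
  x - dt / 2 * (q x + q (x - dt * q x + xi)) + xi.

(* One step m_k |-> m_(k+1) of the scheme. *)
Definition sl_step (R : realType) (L : finType) (q : R -> R) (dt : R)
    (omega xi : L -> R) (f : R -> R) (x : R) : R :=
  \sum_(l : L) omega l * f (psi_minus q dt (xi l) x).

Definition one_step_error (R : realType) (L : finType) (m : R -> R -> R)
    (q : R -> R) (dt : R) (omega xi : L -> R) (k : nat) (x : R) : R :=
  m x (k.+1%:R * dt) - sl_step q dt omega xi (fun y => m y (k%:R * dt)) x.

(* Moments 0, ..., 5 of the quadrature agree with those of N(0, 2 nu dt);
   normal_pdf takes the standard deviation. *)
Definition moment_matching (R : realType) (L : finType) (nu dt : R)
    (omega xi : L -> R) : Prop :=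
  forall j : nat, (j <= 5)%N ->
    \sum_(l : L) omega l * xi l ^+ j =
    \int[@lebesgue_measure R]_(y in setT)
      (y ^+ j * normal_pdf 0 (Num.sqrt (2 * nu * dt)) y).

(* The absolute moments of orders 0 and 6 of the quadrature in the Brownian
   scaling xi = sqrt dt * eta.  It does not depend on dt for a rule obtained by
   scaling a fixed one (e.g. Gauss-Hermite).  The signed moments of orders up to
   5 do not control it. *)
Definition rule_size (R : realType) (L : finType) (dt : R)
    (omega xi : L -> R) : R :=
  \sum_(l : L) `|omega l| * (1 + (xi l ^+ 2 / dt) ^+ 3).

(* Main.v *)
Require Import Defs.
From HB Require Import structures.
From mathcomp Require Import all_boot all_order all_algebra.
From mathcomp Require Import all_classical all_reals all_analysis.
From mathcomp Require Import ring lra measurable_realfun.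
Import Order.TTheory GRing.Theory Num.Theory.
Import numFieldNormedType.Exports.
Local Open Scope classical_set_scope.
Local Open Scope ring_scope.
Set Implicit Arguments.
Unset Strict Implicit.
Unset Printing Implicit Defensive.

(* Put y = x + z with z = xi - dt q(x), so that
   Psi = y + (dt/2) (q(x) - q(y)) and
     m(Psi) = m(y) + (dt/2) (q(x) - q(y)) m_x(y) + O(dt^2 z^2).
   Since q is only C^2, q(y) may not be expanded to the required order; but the
   equation gives q m_x = nu m_xx - m_t, whence
     (q(x) - q(y)) m_x(y) = q(x) m_x(y) - nu m_xx(y) + m_t(y),
   which has four bounded derivatives in y.  Taylor expansions of m (to
   order 6) and of this function (to order 4) in z, together with the moments of
   orders up to 5, reproduce the time expansion
     m(x, t + dt) = m + dt m_t + (dt^2/2) (nu m_xxt - q m_xt) + O(dt^3),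
   and the remainders are O(dt^3) because z^2 = O(dt).  The second moment bounds
   nu by the size of the rule, so the constant need not depend on nu. *)

(** * Moments of the centred Gaussian density *)

(** With [z = y ^+ 2 / (8 * s ^+ 2)] the exponential factors on the two sides are [expR (- (4 * z))]
    and [expR (- z)], which leaves room for a polynomial factor of size [expR z]. The majorant is
    again a Gaussian density, hence integrable and bounded. *)
Lemma expr_normal_pdf_le (R : realType) (s : R) (n : nat) : s != 0 ->
  exists2 C : R, 0 <= C &
    forall y, `|y ^+ n * normal_pdf 0 s y| <= C * normal_pdf 0 (2 * s) y.
Proof.
move=> s0; have s20 : 2 * s != 0 by rewrite mulf_neq0.
have s2_gt0 : 0 < s ^+ 2 by rewrite exprn_even_gt0.
pose A := 1 + (8 * s ^+ 2) ^+ n * n`!%:R : R.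
have A0 : 0 <= A by rewrite addr_ge0// mulr_ge0// exprn_ge0// mulr_ge0// ltW.
exists (A * normal_peak s / normal_peak (2 * s)) => [|y].
  by rewrite divr_ge0 ?mulr_ge0 ?normal_peak_ge0.
rewrite !normal_pdfE// /normal_fun subr0.
pose z := y ^+ 2 / (8 * s ^+ 2).
have z0 : 0 <= z by rewrite divr_ge0 ?sqr_ge0// mulr_ge0// ltW.
rewrite (_ : - y ^+ 2 / (s ^+ 2 *+ 2) = - (4 * z)); last first.
  by rewrite /z; field.
rewrite (_ : - y ^+ 2 / ((2 * s) ^+ 2 *+ 2) = - z); last first.
  by rewrite /z; field.
have peak0 := normal_peak_gt0 s20.
rewrite [leRHS](_ : _ = normal_peak s * (A * expR (- z))); last first.
  by field; rewrite gt_eqF.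
rewrite mulrCA normrM ger0_norm ?normal_peak_ge0// ler_wpM2l ?normal_peak_ge0//.
rewrite normrM (ger0_norm (expR_ge0 _)).
(* [(|y|^n - 1)^2 >= 0] bounds [|y|^n] by [1 + |y|^(2n)]; here [|y|^(2n) = (8 s^2)^n z^n], and
   [z^n <= n! expR z] by the exponential series. This is where [A] comes from. *)
have yn : `|y ^+ n| <= A * expR z.
  have := sqr_ge0 (`|y ^+ n| - 1).
  have ez : z ^+ n <= n`!%:R * expR z.
    case: n {A A0} => [|n]; first by rewrite expr0 fact0 mul1r -expR0 ler_expR.
    have := expR_ge1Dxn n z0; rewrite -(ler_pM2r (x := n.+1`!%:R)) ?ltr0n ?fact_gt0//.
    rewrite mulrDl mul1r divfK ?pnatr_eq0 -?lt0n ?fact_gt0// => h.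
    by rewrite mulrC (le_trans _ h)// lerDr.
  have e1 : 1 <= expR z by rewrite -expR0 ler_expR.
  have y2n : `|y ^+ n| ^+ 2 = (8 * s ^+ 2) ^+ n * z ^+ n.
    rewrite -exprMn /z mulrC divfK ?mulf_neq0 ?expf_neq0//.
    by rewrite real_normK ?num_real// -!exprM mulnC.
  have : (8 * s ^+ 2) ^+ n * z ^+ n <= (8 * s ^+ 2) ^+ n * (n`!%:R * expR z).
    by rewrite ler_wpM2l// exprn_ge0// mulr_ge0// ltW.
  rewrite -y2n /A; have := sqr_ge0 `|y ^+ n|; lra.
apply: le_trans (ler_wpM2r (expR_ge0 _) yn) _.
by rewrite -mulrA ler_wpM2l// -expRD ler_expR; lra.
Qed.

Lemma integrable_expr_normal_pdf (R : realType) (s : R) (n : nat) : s != 0 ->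
  (@lebesgue_measure R).-integrable setT
    (EFin \o (fun y => y ^+ n * normal_pdf 0 s y)).
Proof.
move=> s0; have [C C0 HC] := expr_normal_pdf_le n s0.
have := integrableZl measurableT C (integrable_normal_pdf 0 (2 * s)).
apply: le_integrable => //.
  apply/measurable_EFinP/measurable_funM; last exact: measurable_normal_pdf.
  exact: measurable_funX.
by move=> y _ /=; rewrite lee_fin (le_trans (HC y))// ler_norm.
Qed.

(** The fundamental theorem of calculus on growing symmetric intervals, then dominated convergence
    with majorant [|f|]. *)
Lemma Rintegral_derivative_eq0 (R : realType) (F f : R -> R) :
  (forall x : R, is_derive x 1 F (f x)) -> continuous f ->
  (@lebesgue_measure R).-integrable setT (EFin \o f) ->
  F n%:R - F (- n%:R) @[n --> \oo] --> 0 ->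
  \int[@lebesgue_measure R]_(y in setT) f y = 0.
Proof.
move=> dF cf intf F0.
(* The index [n.+1] keeps the interval nondegenerate, as the fundamental theorem requires. *)
pose I (n : nat) := `[- n.+1%:R, n.+1%:R]%classic : set R.
pose f_ n := (EFin \o f) \_ (I n).
have mI n : measurable (I n) by exact: measurable_itv.
have mf : measurable_fun setT (EFin \o f) by case/integrableP : intf.
have cvg_f_ : (\int[@lebesgue_measure R]_x f_ n x)%E @[n --> \oo] -->
    (\int[@lebesgue_measure R]_x (EFin \o f) x)%E.
  have [||||//] := @dominated_convergence _ _ R (@lebesgue_measure R) setT
    measurableT f_ (EFin \o f) (abse \o (EFin \o f)) _ mf.
  - by move=> n; apply: (measurable_restrictT (EFin \o f) (mI n)).1; exact: measurable_funTS.
  - apply: aeW => x _; apply: cvg_near_cst.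
    have := nbhs_infty_gtr `|x|; apply: filterS => n xn.
    rewrite /f_ patchE ifT// inE /I /= in_itv/= -ler_norml.
    by rewrite (le_trans (ltW xn))// ler_nat.
  - exact: integrable_abse.
  - apply: aeW => x n _; rewrite /f_ patchE; case: ifP => _ //=.
    by rewrite normr0 lee_fin.
have f_E n : (\int[@lebesgue_measure R]_x f_ n x)%E =
    (F n.+1%:R - F (- n.+1%:R))%:E.
  rewrite -integral_mkcond EFinB.
  apply: continuous_FTC2.
  - by rewrite gtrN.
  - exact: continuous_subspaceT.
  - have cF : continuous F.
      by move=> x; apply/differentiable_continuous/derivable1_diffP; case: (dF x).
    split.
    + by move=> x _; case: (dF x).
    + exact/cvg_at_right_filter/cF.
    + exact/cvg_at_left_filter/cF.
  - by move=> x _; rewrite derive1E; have [] := dF x.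
have cvg0 : (\int[@lebesgue_measure R]_x f_ n x)%E @[n --> \oo] --> 0%E.
  rewrite (funext f_E); apply: cvg_EFin; first exact: nearW.
  by move: F0; rewrite -(cvg_shiftS (fun n => F n%:R - F (- n%:R))).
by rewrite /Rintegral (cvg_unique _ cvg_f_ cvg0).
Qed.

Lemma is_derive_expr_normal_pdf (R : realType) (s : R) (n : nat) (y : R) :
  s != 0 ->
  is_derive y 1 (fun y => y ^+ n * normal_pdf 0 s y)
    (n%:R * (y ^+ n.-1 * normal_pdf 0 s y)
     - s ^- 2 * (y ^+ n.+1 * normal_pdf 0 s y)).
Proof.
move=> s0; rewrite normal_pdfE// /normal_fun.
have de : is_derive y 1 (fun y : R => - (y - 0) ^+ 2 / (s ^+ 2 *+ 2))
    (- (y / s ^+ 2)).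
  apply: is_derive_eq; rewrite /GRing.scale/=; field.
  by rewrite s0.
have dX : is_derive y 1 (fun y : R => y ^+ n) (n%:R * y ^+ n.-1).
  have h := is_deriveX n (is_derive_id y (1 : R)).
  rewrite exprfctE in h.
  by apply: is_derive_eq h _; rewrite /GRing.scale/= mulr1.
have dE : is_derive y 1
    (fun y : R => normal_peak s * expR (- (y - 0) ^+ 2 / (s ^+ 2 *+ 2)))
    (normal_peak s * (- (y / s ^+ 2) * expR (- (y - 0) ^+ 2 / (s ^+ 2 *+ 2)))).
  have := @is_derive1_comp _ expR _ _ _ _ (is_derive_expR _) de.
  move=> /(is_deriveZ (normal_peak s)) h.
  by apply: is_derive_eq h _; rewrite /GRing.scale/= [_ * - _]mulrC.
have := is_deriveM dX dE.
move=> h; apply: is_derive_eq h _.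
by rewrite /GRing.scale/= [y ^+ n.+1]exprS; field.
Qed.

(* Integral over R of the derivative of [y ^+ n * normal_pdf 0 s y]; for n = 0
   the right-hand side is 0 and the value of [0.-1] is irrelevant. *)
Lemma normal_moment_rec (R : realType) (s : R) (n : nat) : s != 0 ->
  \int[@lebesgue_measure R]_(y in setT) (y ^+ n.+1 * normal_pdf 0 s y) =
  n%:R * s ^+ 2 *
    \int[@lebesgue_measure R]_(y in setT) (y ^+ n.-1 * normal_pdf 0 s y).
Proof.
move=> s0; set p := normal_pdf 0 s.
have intX k := integrable_expr_normal_pdf k s0.
have intl := integrableZl measurableT n%:R (intX n.-1).
have intr := integrableZl measurableT (s ^- 2) (intX n.+1).
have : \int[@lebesgue_measure R]_(y in setT)
    (n%:R * (y ^+ n.-1 * p y) - s ^- 2 * (y ^+ n.+1 * p y)) = 0.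
  apply: (@Rintegral_derivative_eq0 _ (fun y : R => y ^+ n * p y)).
  - by move=> x; exact: is_derive_expr_normal_pdf.
  - have cX k : continuous (fun y : R => y ^+ k * p y).
      move=> x; apply: cvgM; first exact: exprn_continuous.
      exact: continuous_normal_pdf.
    by move=> x; apply: cvgB; apply: cvgM;
      [exact: cvg_cst|exact: cX|exact: cvg_cst|exact: cX].
  - exact: (integrableB measurableT intl intr).
  - have [C C0 HC] := expr_normal_pdf_le n.+1 s0.
    pose K := C * normal_peak (2 * s).
    (* The boundary terms decay like [1 / |y|] because [y ^+ n.+1 * p y] is bounded. The sequence is
       then shifted by one to avoid [y = 0]. *)
    have HK y : y != 0 -> `|y ^+ n * p y| <= K / `|y|.
      move=> y0; rewrite ler_pdivlMr ?normr_gt0// -normrM mulrAC -exprSr.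
      rewrite (le_trans (HC y))// ler_wpM2l//.
      by rewrite normal_pdf_ub// mulf_neq0.
    rewrite -(cvg_shiftS (fun k => k%:R ^+ n * p k%:R - (- k%:R) ^+ n * p (- k%:R))).
    apply/norm_cvg0P; apply: (@squeeze_cvgr _ _ _ _ (cst 0) (fun k => 2 * K * harmonic k)).
    + near=> k; rewrite normr_ge0/= (le_trans (ler_normB _ _))//.
      have k0 : k.+1%:R != 0 :> R by rewrite pnatr_eq0.
      have := HK k.+1%:R k0; have := HK (- k.+1%:R); rewrite oppr_eq0 => /(_ k0).
      rewrite normrN (ger0_norm (ler0n R k.+1)) => hN hP.
      by rewrite -mulrA [2 * _]mulr_natl mulr2n lerD.
    + exact: cvg_cst.
    + rewrite -[X in _ --> X](mulr0 (2 * K)); apply: cvgM; first exact: cvg_cst.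
      exact: cvg_harmonic.
rewrite RintegralB// !RintegralZl// => /eqP; rewrite subr_eq0 => /eqP h.
by rewrite mulrAC h mulrC mulVKf// expf_neq0.
Unshelve. all: by end_near. Qed.

Lemma normal_moments (R : realType) (s : R) : s != 0 ->
  let E j := \int[@lebesgue_measure R]_(y in setT) (y ^+ j * normal_pdf 0 s y) in
  [/\ E 0%N = 1, E 1%N = 0 & E 2%N = s ^+ 2] /\
  [/\ E 3%N = 0, E 4%N = 3 * (s ^+ 2) ^+ 2 & E 5%N = 0].
Proof.
move=> s0 E.
have rec n : E n.+1 = n%:R * s ^+ 2 * E n.-1 by exact: normal_moment_rec.
have E0 : E 0%N = 1.
  rewrite /E /Rintegral; under eq_integral do rewrite expr0 mul1r.
  by rewrite integral_normal_pdf.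
have E1 : E 1%N = 0 by rewrite rec !mul0r.
have E2 : E 2%N = s ^+ 2 by rewrite rec /= E0 mul1r mulr1.
have E3 : E 3%N = 0 by rewrite rec /= E1 mulr0.
split; split => //; last by rewrite rec /= E3 mulr0.
by rewrite rec /= E2 -mulrA -expr2.
Qed.

(** * Taylor expansions with explicit remainder *)

(* The remainder is bounded without the factor s ^+ n / n`!, so that the induction
   carries a constant. *)
Lemma taylor_unit_itv (R : realType) (n : nat) (f : nat -> R -> R) (K : R) :
  (forall i, (i < n)%N -> {within `[0, 1], continuous (f i)}) ->
  (forall i, (i < n)%N ->
     forall s : R, 0 < s < 1 -> is_derive s 1 (f i) (f i.+1 s)) ->
  (forall s : R, 0 <= s <= 1 -> `|f n s| <= K) ->
  forall s : R, 0 <= s <= 1 ->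
    `|f 0%N s - \sum_(i < n) f i 0 / i`!%:R * s ^+ i| <= K.
Proof.
elim: n f => [|n IH] f cf df bf s s01.
  by rewrite big_ord0 subr0 bf.
pose P (u : R) := \sum_(i < n.+1) f i 0 / i`!%:R * u ^+ i.
pose P' (u : R) := \sum_(i < n) f i.+1 0 / i`!%:R * u ^+ i.
(* [P'] is the Taylor polynomial of [f 1], so the induction hypothesis bounds the derivative of
   [f 0 - P] by [K]. The mean value theorem between 0 and [s <= 1] concludes, as [f 0 - P] vanishes
   at 0. *)
have IH' (u : R) : 0 <= u <= 1 -> `|f 1%N u - P' u| <= K.
  move=> u01; apply: (IH (fun i => f i.+1)) => // i ltin; [exact: cf|exact: df].
have dP (u : R) : is_derive u 1 P (P' u).
  rewrite (_ : P = \sum_(i < n.+1) (fun u => f i 0 / i`!%:R * u ^+ i)); last first.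
    by apply/funext => v; rewrite fct_sumE.
  have dmon (i : 'I_n.+1) : is_derive u 1 (fun u => f i 0 / i`!%:R * u ^+ i)
      (f i 0 / i`!%:R * (i%:R * u ^+ i.-1)).
    have h := is_deriveX i (is_derive_id u (1 : R)).
    rewrite exprfctE in h.
    have := is_deriveZ (f i 0 / i`!%:R) h.
    by move=> h'; apply: is_derive_eq h' _; rewrite /GRing.scale/= mulr1.
  have h := is_derive_sum dmon.
  apply: is_derive_eq h _; rewrite big_ord_recl/= mul0r mulr0 add0r.
  apply: eq_bigr => i _; rewrite /bump/= add1n factS natrM.
  have c0 : i.+1%:R != 0 :> R by rewrite pnatr_eq0.
  have d0 : i`!%:R != 0 :> R by rewrite pnatr_eq0 -lt0n fact_gt0.
  by move: c0 d0; move: (i.+1%:R : R) (i`!%:R : R) => c d c0 d0; field; rewrite c0 d0.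
case/andP: s01 => s0 s1.
have [||c] := @MVT_segment R (fun u => f 0%N u - P u) (fun u => f 1%N u - P' u)
  0 s s0.
- move=> u; rewrite in_itv/= => /andP[u0 us].
  have u01 : 0 < u < 1 by rewrite u0 (lt_le_trans us).
  have d0 := df 0%N isT u u01.
  exact: (is_deriveB d0 (dP u)).
- have cP : {within `[0, 1], continuous P}.
    apply: continuous_subspaceT => u.
    by apply/differentiable_continuous/derivable1_diffP; case: (dP u).
  have cg : {within `[0, 1], continuous (fun u => f 0%N u - P u)}.
    by move=> u; apply: cvgB; [exact: cf|exact: cP].
  by apply: continuous_subspaceW cg; apply: subset_itvl; rewrite bnd_simp.
rewrite in_itv/= => /andP[c0 cs] /=.
have -> : P 0 = f 0%N 0.
  rewrite /P big_ord_recl/= expr0 fact0 mulr1 divr1 big1 ?addr0// => i _.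
  by rewrite /bump/= expr0n mulr0.
rewrite subrr !subr0 -/(P s) => ->.
rewrite normrM (ger0_norm s0) (le_trans (ler_wpM2l _ s1))// mulr1.
by rewrite IH'// c0 (le_trans cs).
Qed.

(** The previous lemma along [s |-> x + s * z]: each derivative brings out a factor [z], and the
    sign of [z] does not matter. *)
Lemma taylor_line (R : realType) (n : nat) (f : nat -> R -> R) (K x z : R) :
  (forall i, (i < n)%N -> forall y : R, is_derive y 1 (f i) (f i.+1 y)) ->
  (forall y, `|f n y| <= K) ->
  `|f 0%N (x + z) - \sum_(i < n) f i x / i`!%:R * z ^+ i| <= K * `|z| ^+ n.
Proof.
move=> df bf.
pose g i s := f i (x + s * z) * z ^+ i.
have dg i : (i < n)%N -> forall s : R, is_derive s 1 (g i) (g i.+1 s).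
  move=> ltin s.
  have dl : is_derive s 1 (fun s : R => x + s * z) z.
    by apply: is_derive_eq; rewrite /GRing.scale/=; ring.
  have := @is_derive1_comp _ (f i) (fun s : R => x + s * z) _ _ _ (df _ ltin (x + s * z)) dl.
  move=> /(is_deriveZ (z ^+ i)) h.
  rewrite (_ : g i = z ^+ i \*: (f i \o (fun s : R => x + s * z))); last first.
    by apply/funext => u; rewrite /g mulrC.
  by apply: is_derive_eq h _; rewrite /GRing.scale/= /g exprS; ring.
have := @taylor_unit_itv _ n g (K * `|z| ^+ n) _ _ _ 1.
have -> : \sum_(i < n) g i 0 / i`!%:R * 1 ^+ i
        = \sum_(i < n) f i x / i`!%:R * z ^+ i.
  by apply: eq_bigr => i _; rewrite /g mul0r addr0 expr1n mulr1 mulrAC.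
have -> : g 0%N 1 = f 0%N (x + z) by rewrite /g mul1r expr0 mulr1.
apply.
- move=> i ltin; apply: continuous_subspaceT => u.
  by apply/differentiable_continuous/derivable1_diffP; case: (dg i ltin u).
- by move=> i ltin s _; exact: dg.
- by move=> s _; rewrite /g normrM normrX ler_wpM2r// exprn_ge0.
- by rewrite ler01 lexx.
Qed.

(** * Expansions of the solution in time and in space *)

(** A time step may start at 0 or end at [T], where the time derivatives are not given. The time
    expansion therefore uses differentiability inside the step only, and continuity up to its
    endpoints, which is inherited from the slab. *)
Lemma slab_line_continuous (R : realType) (T t h x : R) (f : R -> R -> R) :
  0 <= t -> 0 <= h -> t + h <= T ->
  {within slab T, continuous (fun p : R * R => f p.1 p.2)} ->
  {within `[0, 1], continuous (fun s => f x (t + s * h))}.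
Proof.
move=> t0 h0 thT /subspace_continuousP cf; apply/subspace_continuousP => s.
pose g (s : R) := (x, t + s * h) : R * R.
have gslab u : u \in `[0, 1] -> slab T (g u).
  by rewrite in_itv/= /slab/= => /andP[u0 u1]; apply/andP; split; nra.
move=> s01; have cfs := cf (g s) (gslab s s01).
apply: (@cvg_comp _ _ _ g (fun p => f p.1 p.2) _ _ _ _ cfs) => B; rewrite /within/= => nB.
have cg : g u @[u --> s] --> g s.
  have c1 : (x : R) @[u --> s] --> x by exact: cvg_cst.
  have c2 : t + u * h @[u --> s] --> t + s * h.
    by apply: cvgD; [exact: cvg_cst|apply: cvgM; [exact: cvg_id|exact: cvg_cst]].
  exact: (cvg_pair c1 c2).
suff : \forall u \near s, `[0, 1]%classic u -> B (g u) by [].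
have nB' : \forall u \near s, slab T (g u) -> B (g u) := cg _ nB.
by apply: filterS nB' => u Bu u01; apply: Bu; exact: gslab.
Qed.

(** Only the first time derivative is rewritten by the equation; as [q] does not depend on time, the
    later ones fall on [D] alone. The third involves [D 2 2] and [D 1 2], of parabolic orders 6 and
    5, whence the factor [(nu + M) * M]. *)
Lemma time_expansion (R : realType) (T nu : R) (q : R -> R) (m : R -> R -> R)
    (D : nat -> nat -> R -> R -> R) (M t h x : R) :
  0 < nu -> smooth_on_slab T m D ->
  (forall x t : R, 0 <= t <= T ->
     D 0%N 1%N x t - nu * D 2%N 0%N x t + q x * D 1%N 0%N x t = 0) ->
  derivatives_bounded T D q M -> 0 <= t -> 0 < h -> t + h <= T ->
  `|D 0%N 0%N x (t + h) - (D 0%N 0%N x t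
     + h * (nu * D 2%N 0%N x t - q x * D 1%N 0%N x t)
     + h ^+ 2 / 2 * (nu * D 2%N 1%N x t - q x * D 1%N 1%N x t))|
  <= (nu + M) * M * h ^+ 3.
Proof.
move=> nu0 [_ cD _ dt] pde [bD bq] t0 h0 thT.
pose F j s := h ^+ j.+1 * (nu * D 2%N j x (t + s * h) - q x * D 1%N j x (t + s * h)).
pose f i := if i is j.+1 then F j else fun s => D 0%N 0%N x (t + s * h).
have inT s : 0 < s < 1 -> 0 < t + s * h < T.
  by move=> /andP[s0 s1]; apply/andP; split; nra.
have inT' s : 0 <= s <= 1 -> 0 <= t + s * h <= T.
  by move=> /andP[s0 s1]; apply/andP; split; nra.
have cD' i j := @slab_line_continuous R T t h x (D i j) t0 (ltW h0) thT (cD i j).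
have dD i j (s : R) : 0 < s < 1 ->
    is_derive s 1 (fun s => D i j x (t + s * h)) (h * D i j.+1 x (t + s * h)).
  move=> s01.
  have dl : is_derive s 1 (fun s : R => t + s * h) h.
    by apply: is_derive_eq; rewrite /GRing.scale/=; ring.
  have := @is_derive1_comp _ (D i j x) (fun s : R => t + s * h) _ _ _
    (dt i j x _ (inT s s01)) dl.
  by move=> h'; apply: is_derive_eq h' _; rewrite mulrC.
have := @taylor_unit_itv R 3 f ((nu + M) * M * h ^+ 3) _ _ _ 1.
have -> : \sum_(i < 3) f i 0 / i`!%:R * 1 ^+ i = D 0%N 0%N x t
     + h * (nu * D 2%N 0%N x t - q x * D 1%N 0%N x t)
     + h ^+ 2 / 2 * (nu * D 2%N 1%N x t - q x * D 1%N 1%N x t).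
  rewrite !big_ord_recl big_ord0 /= /F /bump/= !factS fact0 mul0r !addr0.
  by rewrite !expr1n; field.
have -> : D 0%N 0%N x (t + h) = f 0%N 1 by rewrite /= mul1r.
apply.
- move=> [|j] _; first exact: cD'.
  move=> s; apply: cvgM; first exact: cvg_cst.
  by apply: cvgB; (apply: cvgM; [exact: cvg_cst|exact: cD']).
- move=> [|j] ltj s s01.
    apply: is_derive_eq (dD 0%N 0%N s s01) _; rewrite /= /F expr1; congr (_ * _).
    by have := pde x _ (inT' s _); lra.
  have h1 := is_deriveZ nu (dD 2%N j s s01).
  have h2 := is_deriveZ (q x) (dD 1%N j s s01).
  have h3 := is_deriveZ (h ^+ j.+1) (is_deriveB h1 h2).
  by apply: is_derive_eq h3 _; rewrite /GRing.scale/= /F [h ^+ j.+2]exprS; ring.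
- move=> s s01; rewrite /= /F.
  have b1 := bD 2%N 2%N isT x _ (inT' s s01).
  have b2 := bD 1%N 2%N isT x _ (inT' s s01).
  have bQ := bq 0%N isT x.
  rewrite normrM mulrC (ger0_norm (exprn_ge0 _ (ltW h0))) ler_wpM2r//.
    by rewrite exprn_ge0// ltW.
  rewrite (le_trans (ler_normB _ _))// mulrDl !normrM (ger0_norm (ltW nu0)).
  by rewrite lerD// ?ler_wpM2l ?ler_pM// ltW.
- by rewrite ler01 lexx.
Qed.

(* By the equation, [drift_gap 0] is [y |-> (q x - q y) * dm/dx (y, t)], and
   [drift_gap i] is its i-th derivative, expressed without derivatives of q. *)
Definition drift_gap (R : realType) (nu : R) (q : R -> R)
    (D : nat -> nat -> R -> R -> R) (t x : R) (i : nat) (y : R) : R :=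
  q x * D i.+1 0%N y t - nu * D i.+2 0%N y t + D i 1%N y t.

(** The three terms of the bound are, in order, the remainders of [m] at order 6 in [z], of
    [drift_gap] at order 4 in [z], and of the move from [x + z] to the foot of the characteristic at
    order 2. All powers of [z] in it are even, so no absolute value remains. *)
Lemma space_expansion (R : realType) (T nu : R) (q : R -> R) (m : R -> R -> R)
    (D : nat -> nat -> R -> R -> R) (M t h x xi : R) :
  0 < nu -> C2 q -> smooth_on_slab T m D ->
  (forall x t : R, 0 <= t <= T ->
     D 0%N 1%N x t - nu * D 2%N 0%N x t + q x * D 1%N 0%N x t = 0) ->
  derivatives_bounded T D q M -> 0 <= t <= T -> 0 < h ->
  forall z, z = xi - h * q x ->
  `|D 0%N 0%N (psi_minus q h xi x) t
    - (\sum_(i < 6) D i 0%N x t / i`!%:R * z ^+ i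
       + h / 2 * \sum_(i < 4) drift_gap nu q D t x i x / i`!%:R * z ^+ i)|
  <= M * z ^+ 6 + h / 2 * ((M * M + nu * M + M) * z ^+ 4)
     + M * (h / 2 * (M * z)) ^+ 2.
Proof.
move=> nu0 [dq _ _] [_ _ dx _] pde [bD bq] tT h0 z zE.
have normX k : ~~ odd k -> `|z| ^+ k = z ^+ k.
  by move=> ek; rewrite -normrX ger0_norm// exprn_even_ge0.
pose y := x + z.
have hm : `|D 0%N 0%N y t - \sum_(i < 6) D i 0%N x t / i`!%:R * z ^+ i|
    <= M * z ^+ 6.
  rewrite -(normX 6%N isT); apply: (taylor_line (f := fun i y => D i 0%N y t)).
    by move=> i _ u; exact: dx.
  by move=> u; exact: bD.
pose G := drift_gap nu q D t x.
have hG : `|G 0%N y - \sum_(i < 4) G i x / i`!%:R * z ^+ i|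
    <= (M * M + nu * M + M) * z ^+ 4.
  rewrite -(normX 4%N isT); apply: (taylor_line (f := G)).
    move=> i _ u.
    have h1 := is_deriveZ (q x) (dx i.+1 0%N u t tT).
    have h2 := is_deriveZ nu (dx i.+2 0%N u t tT).
    exact: is_deriveD (is_deriveB h1 h2) (dx i 1%N u t tT).
  move=> u; rewrite /G /drift_gap.
  have b1 := bD 5%N 0%N isT u t tT; have b2 := bD 6%N 0%N isT u t tT.
  have b3 := bD 4%N 1%N isT u t tT; have bQ := bq 0%N isT x.
  rewrite (le_trans (ler_normD _ _))// lerD// (le_trans (ler_normB _ _))//.
  by rewrite !normrM (ger0_norm (ltW nu0)) lerD ?ler_wpM2l ?ler_pM// ltW.
(* The expansion with one term is the mean value inequality; it makes the displacement [w] of size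
   [h * |z|]. *)
have hq : `|q y - q x| <= M * `|z|.
  have := @taylor_line R 1 (fun i => derive1n i q) M x z.
  rewrite big_ord1 fact0 divr1 expr0 mulr1 expr1; apply.
    by move=> [|//] _ u; apply: DeriveDef => //=; rewrite derive1E.
  by move=> u; exact: (bq 1%N).
pose w := h / 2 * (q x - q y).
have psiE : psi_minus q h xi x = y + w.
  have yE : y = x - h * q x + xi by rewrite /y zE; ring.
  by rewrite /psi_minus /w -yE /y zE; field.
have hw : `|D 0%N 0%N (y + w) t - (D 0%N 0%N y t + h / 2 * G 0%N y)|
    <= M * (h / 2 * (M * z)) ^+ 2.
  have := @taylor_line R 2 (fun i u => D i 0%N u t) M y w _ _.
  rewrite !big_ord_recl big_ord0 /= /bump/= expr0 expr1 !divr1 mulr1 addr0.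
  have -> : D 1%N 0%N y t * w = h / 2 * G 0%N y.
    have := pde y t tT; rewrite /w /G /drift_gap => e.
    have -> : D 0%N 1%N y t = nu * D 2%N 0%N y t - q y * D 1%N 0%N y t by lra.
    by field.
  move=> /(_ (fun i _ u => dx i 0%N u t tT) (fun u => bD 2%N 0%N isT u t tT)).
  move=> /le_trans; apply.
  have M0 : 0 <= M by rewrite (le_trans _ (bq 0%N isT x)).
  rewrite ler_wpM2l// -[leRHS]ger0_norm ?sqr_ge0// [leRHS]normrX lerXn2r ?nnegrE//.
  rewrite /w !normrM ler_wpM2l ?mulr_ge0// (ger0_norm M0).
  by rewrite distrC.
rewrite psiE; move: hm hG hw; set P := \sum_(i < 6) _; set P' := \sum_(i < 4) _.
set a := D 0%N 0%N (y + w) t; set b := D 0%N 0%N y t => hm hG hw.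
have -> : a - (P + h / 2 * P') =
    (b - P) + h / 2 * (G 0%N y - P') + (a - (b + h / 2 * G 0%N y)) by ring.
rewrite (le_trans (ler_normD _ _))// lerD// (le_trans (ler_normD _ _))// lerD//.
by rewrite normrM ger0_norm ?ler_wpM2l// divr_ge0// ltW.
Qed.

(** * Powers and moments of the shifted nodes *)

(** With [u = xi ^+ 2 / h], [z ^+ 2 <= 2 * (xi ^+ 2 + (h * Q) ^+ 2)] is at most
    [2 * h * K ^+ 3 * (1 + u)]. Its first three powers are compared with [w = 1 + u ^+ 3] through
    [(1 + u) ^+ k <= 4 * w], which yields the constants 8, 16 and 32. *)
Lemma shifted_node_power_le (R : realType) (h K Q xi : R) :
  0 < h -> h <= K -> 1 <= K -> `|Q| <= K ->
  let z := xi - h * Q in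
  let w := 1 + (xi ^+ 2 / h) ^+ 3 in
  [/\ z ^+ 2 <= 8 * h * K ^+ 3 * w, z ^+ 4 <= 16 * h ^+ 2 * K ^+ 6 * w
    & z ^+ 6 <= 32 * h ^+ 3 * K ^+ 9 * w].
Proof.
move=> h0 hK K1 QK z; set u := xi ^+ 2 / h => w.
have u0 : 0 <= u by rewrite divr_ge0 ?sqr_ge0// ltW.
have xiE : xi ^+ 2 = h * u by rewrite /u mulrC divfK// gt_eqF.
have K0 : 0 <= K by rewrite (le_trans _ K1).
have Q2 : Q ^+ 2 <= K ^+ 2.
  by rewrite -[Q ^+ 2]real_normK ?num_real// lerXn2r ?nnegrE.
have hQ : h * Q ^+ 2 <= K ^+ 3 by rewrite exprS ler_pM ?sqr_ge0// ltW.
have K3 : 1 <= K ^+ 3 by rewrite exprn_ege1.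
pose B := 2 * h * K ^+ 3 * (1 + u).
have B0 : 0 <= B by rewrite /B !mulr_ge0 ?exprn_ge0 ?addr_ge0// ltW.
have zB : z ^+ 2 <= B.
  have h1 : z ^+ 2 <= 2 * h * (u + h * Q ^+ 2).
    by have := sqr_ge0 (xi + h * Q); rewrite /z sqrrB sqrrD; nra.
  have h2 : u + h * Q ^+ 2 <= K ^+ 3 * (1 + u) by nra.
  have h20 : 0 <= 2 * h by rewrite mulr_ge0// ltW.
  by rewrite (le_trans h1)// /B -[leRHS]mulrA ler_wpM2l.
(* For the cube, [4 * w - (1 + u) ^+ 3 = 3 * (1 + u) * (1 - u) ^+ 2]. *)
have s1 := sqr_ge0 (1 - u).
have s2 : 0 <= u * (1 - u) ^+ 2 by rewrite mulr_ge0.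
have w1 : 1 + u <= 4 * w by rewrite /w; nra.
have w2 : (1 + u) ^+ 2 <= 4 * w by rewrite /w; nra.
have w3 : (1 + u) ^+ 3 <= 4 * w by rewrite /w; nra.
have c0 k : 0 <= (2 * h * K ^+ 3) ^+ k.
  by rewrite exprn_ge0// !mulr_ge0 ?exprn_ge0// ltW.
have step k : (1 + u) ^+ k <= 4 * w ->
    (z ^+ 2) ^+ k <= (2 * h * K ^+ 3) ^+ k * (4 * w).
  move=> wk; have /le_trans : (z ^+ 2) ^+ k <= B ^+ k.
    by rewrite lerXn2r ?nnegrE ?sqr_ge0.
  by apply; rewrite /B exprMn ler_wpM2l.
split.
- by have := step 1%N w1; rewrite !expr1; lra.
- by have := step 2%N w2; rewrite -exprM; lra.
- by have := step 3%N w3; rewrite -exprM; lra.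
Qed.

Lemma shifted_moment (R : comRingType) (L : finType) (omega xi : L -> R) (c : R)
    (i : nat) :
  \sum_l omega l * (xi l - c) ^+ i =
  \sum_(k < i.+1) (-1) ^+ k * 'C(i, k)%:R * c ^+ k
     * \sum_l omega l * xi l ^+ (i - k).
Proof.
under eq_bigr => l _ do rewrite exprBn mulr_sumr.
rewrite exchange_big/=; apply: eq_bigr => k _; rewrite mulr_sumr.
by apply: eq_bigr => l _; rewrite -[_ *+ _]mulr_natr; ring.
Qed.

(** An exact identity: all orders below [h ^+ 3] cancel. The hypothesis on [b 0] gives [g 0 = 0],
    which settles order 1. At order 2 the terms in [a 2], [a 3], [a 4] cancel against those inside
    [g 1] and [g 2], and [(nu * b 2 - Q * b 1) / 2] is left. *)
Lemma quadrature_expansion (R : realType) (L : finType) (omega xi : L -> R)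
    (nu h Q : R) (a b g : nat -> R) :
  let E j := \sum_l omega l * xi l ^+ j in
  E 0%N = 1 -> E 1%N = 0 -> E 2%N = 2 * nu * h -> E 3%N = 0 ->
  E 4%N = 3 * (2 * nu * h) ^+ 2 -> E 5%N = 0 ->
  b 0%N = nu * a 2%N - Q * a 1%N ->
  (forall i, g i = Q * a i.+1 - nu * a i.+2 + b i) ->
  \sum_l omega l * (\sum_(i < 6) a i / i`!%:R * (xi l - h * Q) ^+ i
       + h / 2 * \sum_(i < 4) g i / i`!%:R * (xi l - h * Q) ^+ i)
  - (a 0%N + h * (nu * a 2%N - Q * a 1%N)
     + h ^+ 2 / 2 * (nu * b 2%N - Q * b 1%N)) =
  h ^+ 3 * (- (a 3%N * Q ^+ 3 / 6)
    + a 4%N * (12 * (nu * Q ^+ 2) + h * Q ^+ 4) / 24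
    - a 5%N * (60 * (nu ^+ 2 * Q) + 20 * (nu * h * Q ^+ 3) + h ^+ 2 * Q ^+ 5) / 120
    + g 2%N * Q ^+ 2 / 4 - g 3%N * (6 * (nu * Q) + h * Q ^+ 3) / 12).
Proof.
move=> E E0 E1 E2 E3 E4 E5 b0 gE.
pose Z i := \sum_l omega l * (xi l - h * Q) ^+ i.
have -> : \sum_l omega l * (\sum_(i < 6) a i / i`!%:R * (xi l - h * Q) ^+ i
       + h / 2 * \sum_(i < 4) g i / i`!%:R * (xi l - h * Q) ^+ i) =
    \sum_(i < 6) a i / i`!%:R * Z i + h / 2 * \sum_(i < 4) g i / i`!%:R * Z i.
  have lin k (e : nat -> R) : \sum_l omega l * (\sum_(i < k) e i * (xi l - h * Q) ^+ i)
      = \sum_(i < k) e i * Z i.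
    under eq_bigr => l _ do rewrite mulr_sumr.
    rewrite exchange_big/=; apply: eq_bigr => i _; rewrite /Z mulr_sumr.
    by apply: eq_bigr => l _; rewrite mulrCA.
  under eq_bigr => l _ do rewrite mulrDr [X in _ + X]mulrCA.
  by rewrite big_split/= -mulr_sumr (lin 6%N (fun i => a i / i`!%:R))
    (lin 4%N (fun i => g i / i`!%:R)).
have ZE i : Z i = \sum_(k < i.+1) (-1) ^+ k * 'C(i, k)%:R * (h * Q) ^+ k * E (i - k)%N.
  exact: shifted_moment.
(* The [Z i] are the moments of a Gaussian with mean [- (h * Q)] and variance [2 * nu * h]. *)
have Z0 : Z 0%N = 1.
  by rewrite ZE big_ord_recl big_ord0 bin0 /= E0; ring.
have Z1 : Z 1%N = - (h * Q).
  rewrite ZE !big_ord_recl big_ord0 /bump/= ?(binS, bin0, bin0n)/=.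
  by rewrite E0 E1; ring.
have Z2 : Z 2%N = 2 * nu * h + (h * Q) ^+ 2.
  rewrite ZE !big_ord_recl big_ord0 /bump/= ?(binS, bin0, bin0n)/=.
  by rewrite E0 E1 E2; ring.
have Z3 : Z 3%N = - (3 * (h * Q) * (2 * nu * h)) - (h * Q) ^+ 3.
  rewrite ZE !big_ord_recl big_ord0 /bump/= ?(binS, bin0, bin0n)/=.
  by rewrite E0 E1 E2 E3; ring.
have Z4 : Z 4%N = 3 * (2 * nu * h) ^+ 2 + 6 * (h * Q) ^+ 2 * (2 * nu * h)
    + (h * Q) ^+ 4.
  rewrite ZE !big_ord_recl big_ord0 /bump/= ?(binS, bin0, bin0n)/=.
  by rewrite E0 E1 E2 E3 E4; ring.
have Z5 : Z 5%N = - (15 * (h * Q) * (2 * nu * h) ^+ 2)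
    - 10 * (h * Q) ^+ 3 * (2 * nu * h) - (h * Q) ^+ 5.
  rewrite ZE !big_ord_recl big_ord0 /bump/= ?(binS, bin0, bin0n)/=.
  by rewrite E0 E1 E2 E3 E4 E5; ring.
rewrite !big_ord_recl !big_ord0 /= /bump !leq0n !add1n !factS fact0 Z0 Z1 Z2 Z3 Z4 Z5.
by rewrite !gE b0; field.
Qed.

Lemma normM_le_expr (R : numDomainType) (K x y : R) (i j : nat) :
  `|x| <= K ^+ i -> `|y| <= K ^+ j -> `|x * y| <= K ^+ (i + j).
Proof. by move=> xK yK; rewrite normrM exprD ler_pM. Qed.

(** A degree count: since [1 <= K], every monomial is at most [K ^+ 8], the degree of
    [a5 * h ^+ 2 * Q ^+ 5]. The coefficients, with the factor 3 of [g2] and [g3] included, add up to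
    less than 4. *)
Lemma expansion_remainder_le (R : realType) (K nu h Q a3 a4 a5 g2 g3 : R) :
  1 <= K -> `|nu| <= K -> `|h| <= K -> `|Q| <= K ->
  `|a3| <= K -> `|a4| <= K -> `|a5| <= K ->
  `|g2| <= 3 * K ^+ 2 -> `|g3| <= 3 * K ^+ 2 ->
  `|- (a3 * Q ^+ 3 / 6)
    + a4 * (12 * (nu * Q ^+ 2) + h * Q ^+ 4) / 24
    - a5 * (60 * (nu ^+ 2 * Q) + 20 * (nu * h * Q ^+ 3) + h ^+ 2 * Q ^+ 5) / 120
    + g2 * Q ^+ 2 / 4 - g3 * (6 * (nu * Q) + h * Q ^+ 3) / 12|
  <= 4 * K ^+ 8.
Proof.
move=> K1 nuK hK QK a3K a4K a5K g2K g3K.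
have K0 : 0 <= K by rewrite (le_trans _ K1).
(* Dividing by 3 leaves a pure power of [K], so that degrees can be added by [normM_le_expr]. *)
have norm3 g : `|g| <= 3 * K ^+ 2 -> `|g / 3| <= K ^+ 2.
  by move=> gK; rewrite normrM normfV (ger0_norm (ler0n R 3)) ler_pdivrMr// mulrC.
have X k x : `|x| <= K -> `|x ^+ k| <= K ^+ k.
  by move=> xK; rewrite normrX lerXn2r ?nnegrE.
have le8 i x : (i <= 8)%N -> `|x| <= K ^+ i -> - K ^+ 8 <= x <= K ^+ 8.
  by move=> i8 xK; rewrite -ler_norml (le_trans xK)// ler_weXn2l.
have m (x y : R) i j := @normM_le_expr R K x y i j.
have Q1 := X 1%N _ QK; have h1 := X 1%N _ hK; have nu1 := X 1%N _ nuK.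
rewrite !expr1 in Q1 h1 nu1.
have /(le8 4%N _ isT)/andP[? ?] := m _ _ 1%N 3%N a3K (X 3%N _ QK).
have /(le8 4%N _ isT)/andP[? ?] := m _ _ 1%N 3%N a4K (m _ _ 1%N 2%N nuK (X 2%N _ QK)).
have /(le8 6%N _ isT)/andP[? ?] := m _ _ 1%N 5%N a4K (m _ _ 1%N 4%N hK (X 4%N _ QK)).
have /(le8 4%N _ isT)/andP[? ?] := m _ _ 1%N 3%N a5K (m _ _ 2%N 1%N (X 2%N _ nuK) QK).
have /(le8 6%N _ isT)/andP[? ?] :=
  m _ _ 1%N 5%N a5K (m _ _ 2%N 3%N (m _ _ 1%N 1%N nuK hK) (X 3%N _ QK)).
have /(le8 8%N _ isT)/andP[? ?] :=
  m _ _ 1%N 7%N a5K (m _ _ 2%N 5%N (X 2%N _ hK) (X 5%N _ QK)).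
have /(le8 4%N _ isT)/andP[? ?] := m _ _ 2%N 2%N (norm3 _ g2K) (X 2%N _ QK).
have /(le8 4%N _ isT)/andP[? ?] := m _ _ 2%N 2%N (norm3 _ g3K) (m _ _ 1%N 1%N nuK QK).
have /(le8 6%N _ isT)/andP[? ?] :=
  m _ _ 2%N 4%N (norm3 _ g3K) (m _ _ 1%N 3%N hK (X 3%N _ QK)).
have ? : 0 <= K ^+ 8 by rewrite exprn_ge0.
by rewrite ler_norml; apply/andP; split; lra.
Qed.

(** * Assembly of the one-step error *)

(** Termwise comparison, by [u <= 1 + u ^+ 3] for [u = xi ^+ 2 / dt]. *)
Lemma viscosity_le_rule_size (R : realType) (L : finType) (nu dt : R)
    (omega xi : L -> R) : 0 < dt ->
  \sum_l omega l * xi l ^+ 2 = 2 * nu * dt ->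
  2 * nu <= rule_size dt omega xi.
Proof.
move=> dt0 E2; rewrite -(ler_pM2r dt0) -E2 /rule_size mulr_suml.
apply: ler_sum => l _; set u := xi l ^+ 2 / dt.
have u0 : 0 <= u by rewrite divr_ge0 ?sqr_ge0// ltW.
rewrite (_ : xi l ^+ 2 = u * dt); last by rewrite /u divfK// gt_eqF.
rewrite mulrA ler_wpM2r ?(ltW dt0)// (le_trans (ler_norm _))// normrM ler_wpM2l//.
rewrite ger0_norm//; have := mulr_ge0 u0 (sqr_ge0 (1 - u)).
by have := sqr_ge0 (1 - u); nra.
Qed.

(** With [K = 1 + T + M + S], the time remainder, the weighted node remainders and the algebraic
    remainder are at most [2 * K ^+ 2], [58 * K ^+ 11] and [4 * K ^+ 8] times [h ^+ 3]; and 2 + 58 +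
    4 = 64. *)
Lemma one_step_error_le (R : realType) (T nu : R) (q : R -> R)
    (m : R -> R -> R) (D : nat -> nat -> R -> R -> R) (M : R)
    (L : finType) (omega xi : L -> R) (h : R) (k : nat) (x : R) :
  0 < nu -> 0 < h -> k.+1%:R * h <= T -> C2 q -> smooth_on_slab T m D ->
  (forall x t : R, 0 <= t <= T ->
     D 0%N 1%N x t - nu * D 2%N 0%N x t + q x * D 1%N 0%N x t = 0) ->
  derivatives_bounded T D q M -> moment_matching nu h omega xi ->
  `|one_step_error m q h omega xi k x|
  <= 64 * (1 + T + M + rule_size h omega xi) ^+ 11 * h ^+ 3.
Proof.
move=> nu0 h0 kT C2q sm pde bd mom.
set S := rule_size h omega xi; set K := 1 + T + M + S; set t := k%:R * h.
have t0 : 0 <= t by rewrite mulr_ge0// ltW.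
have tSE : k.+1%:R * h = t + h by rewrite -natr1 mulrDl mul1r.
rewrite tSE in kT.
have tT : 0 <= t <= T by rewrite t0 (le_trans _ kT)// lerDl ltW.
have T0 : 0 <= T by case/andP: tT; exact: le_trans.
have [bD bq] := bd.
have M0 : 0 <= M by rewrite (le_trans _ (bq 0%N isT x)).
have S0 : 0 <= S.
  apply: sumr_ge0 => l _; rewrite mulr_ge0// addr_ge0// exprn_ge0//.
  by rewrite divr_ge0 ?sqr_ge0// ltW.
have s_gt0 : 0 < 2 * nu * h by rewrite !mulr_gt0.
have sE : Num.sqrt (2 * nu * h) ^+ 2 = 2 * nu * h by rewrite sqr_sqrtr// ltW.
have s0 : Num.sqrt (2 * nu * h) != 0 by rewrite gt_eqF// sqrtr_gt0.
have [[E0 E1 E2] [E3 E4 E5]] := normal_moments s0.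
rewrite sE in E2 E4.
rewrite -(mom 0%N isT) in E0; rewrite -(mom 1%N isT) in E1.
rewrite -(mom 2%N isT) in E2; rewrite -(mom 3%N isT) in E3.
rewrite -(mom 4%N isT) in E4; rewrite -(mom 5%N isT) in E5.
have nuS : nu <= S by have := viscosity_le_rule_size h0 E2; rewrite -/S; lra.
have K1 : 1 <= K by rewrite /K; lra.
have K0 : 0 <= K by lra.
have MK : M <= K by rewrite /K; lra.
have hK : h <= K by rewrite /K; lra.
have nuK : nu <= K by rewrite /K; lra.
have SK : S <= K by rewrite /K; lra.
have QM : `|q x| <= M by exact: (bq 0%N isT x).
have QK : `|q x| <= K by rewrite (le_trans QM).
have bK i j : (1 <= i + 2 * j <= 6)%N -> `|D i j x t| <= K.
  by move=> ij; rewrite (le_trans (bD _ _ ij _ _ tT)).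
pose a i := D i 0%N x t; pose b i := D i 1%N x t.
pose g i := drift_gap nu q D t x i x.
pose P l := \sum_(i < 6) a i / i`!%:R * (xi l - h * q x) ^+ i
       + h / 2 * \sum_(i < 4) g i / i`!%:R * (xi l - h * q x) ^+ i.
pose tau := a 0%N + h * (nu * a 2%N - q x * a 1%N)
     + h ^+ 2 / 2 * (nu * b 2%N - q x * b 1%N).
have b0 : b 0%N = nu * a 2%N - q x * a 1%N by have := pde x t tT; rewrite /a /b; lra.
have alg := @quadrature_expansion R L omega xi nu h (q x) a b g
  E0 E1 E2 E3 E4 E5 b0 (fun i => erefl).
rewrite -/tau in alg.
have K2 : K <= K ^+ 2 by rewrite expr2 ler_peMl.
have gK i : (2 <= i <= 3)%N -> `|g i| <= 3 * K ^+ 2.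
  move=> ij; rewrite /g /drift_gap.
  have d1 : `|D i.+1 0%N x t| <= K by apply: bK; case: (i) ij => [|[|[|[|]]]].
  have d2 : `|D i.+2 0%N x t| <= K by apply: bK; case: (i) ij => [|[|[|[|]]]].
  have d3 : `|D i 1%N x t| <= K by apply: bK; case: (i) ij => [|[|[|[|]]]].
  have p1 : `|q x * D i.+1 0%N x t| <= K ^+ 2 by rewrite normrM expr2 ler_pM.
  have p2 : `|nu * D i.+2 0%N x t| <= K ^+ 2.
    by rewrite normrM expr2 ler_pM// ger0_norm// ltW.
  have := ler_normD (q x * D i.+1 0%N x t - nu * D i.+2 0%N x t) (D i 1%N x t).
  have := ler_normB (q x * D i.+1 0%N x t) (nu * D i.+2 0%N x t).
  lra.
have rem := @expansion_remainder_le R K nu h (q x) (a 3%N) (a 4%N) (a 5%N)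
  (g 2%N) (g 3%N) K1.
have {}rem := rem _ _ QK (bK 3%N 0%N isT) (bK 4%N 0%N isT) (bK 5%N 0%N isT)
  (gK 2%N isT) (gK 3%N isT).
rewrite (ger0_norm (ltW nu0)) (ger0_norm (ltW h0)) in rem.
have {}rem := rem nuK hK.
have h3 : 0 <= h ^+ 3 by rewrite exprn_ge0// ltW.
have algK : `|\sum_l omega l * P l - tau| <= 4 * K ^+ 8 * h ^+ 3.
  by rewrite alg normrM (ger0_norm h3) mulrC ler_wpM2r.
have timeK := @time_expansion R T nu q m D M t h x nu0 sm pde bd t0 h0 kT.
(* 58 = 32 + 24 + 2, from the terms in [z ^+ 6], [z ^+ 4] and [z ^+ 2]. *)
have nodeK l : `|m (psi_minus q h (xi l) x) t - P l|
    <= 58 * K ^+ 10 * h ^+ 3 * (1 + (xi l ^+ 2 / h) ^+ 3).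
  have [mD _ _ _] := sm; rewrite -mD//.
  have := @space_expansion R T nu q m D M t h x (xi l) nu0 C2q sm pde bd tT h0 _ erefl.
  move=> /le_trans; apply.
  have [z2 z4 z6] := shifted_node_power_le (xi l) h0 hK K1 QK.
  set z := xi l - h * q x in z2 z4 z6 *.
  set w := 1 + (xi l ^+ 2 / h) ^+ 3 in z2 z4 z6 *.
  have w0 : 0 <= w.
    by rewrite /w addr_ge0// exprn_ge0// divr_ge0 ?sqr_ge0// ltW.
  have e6 : M * z ^+ 6 <= 32 * K ^+ 10 * h ^+ 3 * w.
    have -> : 32 * K ^+ 10 * h ^+ 3 * w = K * (32 * h ^+ 3 * K ^+ 9 * w) by ring.
    by rewrite ler_pM// exprn_even_ge0.
  have e4 : h / 2 * ((M * M + nu * M + M) * z ^+ 4) <= 24 * K ^+ 8 * h ^+ 3 * w.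
    have -> : 24 * K ^+ 8 * h ^+ 3 * w
        = h / 2 * (3 * K ^+ 2 * (16 * h ^+ 2 * K ^+ 6 * w)) by field.
    have MM : M * M + nu * M + M <= 3 * K ^+ 2.
      have p1 : M * M <= K * K by rewrite ler_pM.
      have p2 : nu * M <= K * K by rewrite ler_pM// ltW.
      by rewrite expr2 in K2 *; lra.
    rewrite ler_wpM2l ?divr_ge0 ?(ltW h0)// ler_pM// ?exprn_even_ge0//.
    by rewrite !addr_ge0 ?mulr_ge0// ltW.
  have e2 : M * (h / 2 * (M * z)) ^+ 2 <= 2 * K ^+ 6 * h ^+ 3 * w.
    have -> : M * (h / 2 * (M * z)) ^+ 2 = h ^+ 2 / 4 * (M ^+ 3 * z ^+ 2) by field.
    have -> : 2 * K ^+ 6 * h ^+ 3 * w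
        = h ^+ 2 / 4 * (K ^+ 3 * (8 * h * K ^+ 3 * w)) by field.
    rewrite ler_wpM2l ?divr_ge0 ?sqr_ge0// ler_pM ?sqr_ge0 ?exprn_ge0//.
    by rewrite lerXn2r ?nnegrE.
  have hw : 0 <= h ^+ 3 * w by rewrite mulr_ge0.
  have : K ^+ 8 * (h ^+ 3 * w) <= K ^+ 10 * (h ^+ 3 * w).
    by rewrite ler_wpM2r// ler_weXn2l.
  have : K ^+ 6 * (h ^+ 3 * w) <= K ^+ 10 * (h ^+ 3 * w).
    by rewrite ler_wpM2r// ler_weXn2l.
  by lra.
(* Summing the node bounds against [|omega l|] produces [S] exactly, and [S <= K] gives the eleventh
   power. *)
have sumK : `|\sum_l omega l * (m (psi_minus q h (xi l) x) t - P l)|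
    <= 58 * K ^+ 11 * h ^+ 3.
  have le1 : `|\sum_l omega l * (m (psi_minus q h (xi l) x) t - P l)|
      <= 58 * K ^+ 10 * h ^+ 3 * S.
    rewrite (le_trans (ler_norm_sum _ _ _))// /S /rule_size mulr_sumr.
    by apply: ler_sum => l _; rewrite normrM mulrCA ler_wpM2l.
  rewrite (le_trans le1)// [leRHS](_ : _ = 58 * K ^+ 10 * h ^+ 3 * K); last by ring.
  by rewrite ler_wpM2l// mulr_ge0// mulr_ge0// exprn_ge0.
have mT : m x (k.+1%:R * h) = D 0%N 0%N x (t + h).
  by have [mD _ _ _] := sm; rewrite tSE -mD// kT addr_ge0// ltW.
(* [tau] is the common second-order expansion of the exact solution and of the scheme. *)
have -> : one_step_error m q h omega xi k x =
    (D 0%N 0%N x (t + h) - tau)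
    - \sum_l omega l * (m (psi_minus q h (xi l) x) t - P l)
    - (\sum_l omega l * P l - tau).
  rewrite /one_step_error mT /sl_step -/t.
  under [X in _ = _ - X - _]eq_bigr => l _ do rewrite mulrBr.
  by rewrite sumrB; ring.
have nuM : (nu + M) * M <= 2 * K ^+ 2.
  have p1 : M * M <= K * K by rewrite ler_pM.
  have p2 : nu * M <= K * K by rewrite ler_pM// ltW.
  by rewrite expr2; lra.
have {}timeK : `|D 0%N 0%N x (t + h) - tau| <= 2 * K ^+ 2 * h ^+ 3.
  by rewrite (le_trans timeK)// ler_wpM2r.
rewrite (le_trans (ler_normB _ _))//.
have := ler_normB (D 0%N 0%N x (t + h) - tau)
  (\sum_l omega l * (m (psi_minus q h (xi l) x) t - P l)).
have : K ^+ 2 * h ^+ 3 <= K ^+ 11 * h ^+ 3 by rewrite ler_wpM2r// ler_weXn2l.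
have : K ^+ 8 * h ^+ 3 <= K ^+ 11 * h ^+ 3 by rewrite ler_wpM2r// ler_weXn2l.
by lra.
Qed.

Theorem proposition3p1 (R : realType) :
  exists C : R -> R -> R -> R,
  forall (T nu : R) (q : R -> R) (m : R -> R -> R)
    (D : nat -> nat -> R -> R -> R) (M : R) (N : nat)
    (L : finType) (omega xi : L -> R),
  let dt := T / N%:R in
  0 < T -> 0 < nu -> (0 < N)%N ->
  C2 q ->
  smooth_on_slab T m D ->
  (forall x t : R, 0 <= t <= T ->
     D 0%N 1%N x t - nu * D 2%N 0%N x t + q x * D 1%N 0%N x t = 0) ->
  derivatives_bounded T D q M ->
  moment_matching nu dt omega xi ->
  (ereal_sup [set (`|one_step_error m q dt omega xi p.2 p.1|)%:E
                | p in [set: R * 'I_N]]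
     <= (C T M (rule_size dt omega xi) * dt ^+ 3)%:E)%E.
Proof.
exists (fun T M S => 64 * (1 + T + M + S) ^+ 11).
move=> T nu q m D M N L omega xi dt T0 nu0 N0 C2q sm pde bd mom.
have dt0 : 0 < dt by rewrite divr_gt0// ltr0n.
apply: ge_ereal_sup => _ [[x k] _ <-] /=; rewrite lee_fin.
apply: (@one_step_error_le R T nu q m D) => //.
(* [k < N] places the end [k.+1%:R * dt] of the step within [T]. *)
have -> : T = N%:R * dt by rewrite /dt mulrC divfK// pnatr_eq0 -lt0n.
by rewrite ler_wpM2r ?(ltW dt0)// ler_nat.
Qed.
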